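(* Let $A\in\mathbb C^{6\times 6}$ be a reciprocal matrix with superdiagonal entries $b_j$ and subdiagonal entries $c_j=b_j^{-1}$, and let $A_j=\frac12(|b_j|^2+|c_j|^2)$ for $j=1,\dots,5$ (so $A_j\ge1$). Then the Kippenhahn curve $C(A)$ consists of three concentric ellipses if and only if the following three equations hold: $$-(A_2^2+A_4^2)-2(A_1^2+A_5^2)+2A_3(A_1-A_2-A_4+A_5)+3(A_1A_4+A_1A_5+A_2A_5)-4(A_1A_2+A_4A_5)+5A_2A_4=0,$$ $$A_2^2-A_3^2+A_4^2+3(A_1A_3+A_1A_5+A_3A_5)-2(A_1^2+A_5^2+A_2A_3-A_2A_4+A_3A_4)-(A_1+A_5)(A_2+A_4)=0,$$ $$\begin{aligned}&-A_1^3+A_2^3+A_3^3+A_4^3-A_5^3+(A_1-A_3+A_5)(A_2^2+A_4^2)-2(A_2+A_4)(A_1^2+A_3^2+A_5^2)\\&+2A_2A_4(A_1-A_3+A_5)-3(A_2+A_4)\big(A_3(A_1+A_5)-A_2A_4\big)-3(A_1+A_5)(A_3^2+A_1A_5)\\&-4(A_1^2A_3+A_3A_5^2+A_1A_2A_5+A_1A_4A_5)+41A_1A_3A_5=0,\end{aligned}$$ and in addition $A_1+A_2+A_3+A_4+A_5>5$.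
   Context: A reciprocal matrix is a tridiagonal matrix $A\in\mathbb C^{n\times n}$ with zero main diagonal, superdiagonal entries $b_1,\dots,b_{n-1}$ and subdiagonal entries $c_1,\dots,c_{n-1}$ satisfying $b_jc_j=1$ for all $j$. Kippenhahn curve: write $\operatorname{Re}M=(M+M^* )/2$ and $P_A(\lambda,\theta)=\det(\operatorname{Re}(e^{i\theta}A)-\lambda I)$ (the NR generating polynomial). $C(A)$ is the class-$n$ algebraic curve in $\mathbb C\cong\mathbb R^2$ whose tangent lines are $\{e^{-i\theta}(\lambda_k(\theta)+it):t\in\mathbb R\}$, $k=1,\dots,n$, $\theta\in\mathbb R$, where $\lambda_1(\theta),\dots,\lambda_n(\theta)$ are the eigenvalues of $\operatorname{Re}(e^{i\theta}A)$. Components of $C(A)$ (with multiplicity) correspond to factors of $P_A$: an ellipse centered at $w_0\in\mathbb C$ corresponds to the factor $(\lambda-\operatorname{Re}(e^{i\theta}w_0))^2-(x\cos 2\theta+y\sin 2\theta+z)$ with the corresponding $x,y,z\in\mathbb R$, $z\ge\sqrt{x^2+y^2}$, $z>0$; when $z=\sqrt{x^2+y^2}$ the ellipse is degenerate, namely the doubleton of its foci. ''$C(A)$ consists of three concentric ellipses'' means that $P_A$ is the product of three such factors with a common center $w_0$, where some, but not all, of the three ellipses are allowed to be degenerate. *)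

(* Defs.v *)
From mathcomp Require Import all_boot all_order all_algebra.
From mathcomp Require Import complex.
From mathcomp Require Import reals trigo.

Set Implicit Arguments.
Unset Strict Implicit.
Unset Printing Implicit Defensive.

Import Order.TTheory GRing.Theory Num.Theory.

Local Open Scope ring_scope.
Local Open Scope complex_scope.
Local Open Scope sesquilinear_scope.


Definition superdiag (K : nzRingType) n (A : 'M[K]_n.+1) (j : 'I_n) : K :=
  A (widen_ord (leqnSn n) j) (lift ord0 j).

Definition subdiag (K : nzRingType) n (A : 'M[K]_n.+1) (j : 'I_n) : K :=
  A (lift ord0 j) (widen_ord (leqnSn n) j).

Definition reciprocal (K : nzRingType) n (A : 'M[K]_n.+1) : Prop :=
  (forall i k : 'I_n.+1, i.+1 != k -> k.+1 != i -> A i k = 0) /\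
  (forall j : 'I_n, superdiag A j * subdiag A j = 1).

Section Kippenhahn.
Variable R : realType.
Implicit Types (theta lambda x y z : R) (w : R[i]).

(* Mathematical indices start at 1: the usual A_j is
   modulus_mean A (j - 1). *)
Definition modulus_mean n (A : 'M[R[i]]_n.+1) (j : 'I_n) : R :=
  (Normc.normc (superdiag A j) ^+ 2 + Normc.normc (subdiag A j) ^+ 2) / 2.

Definition expi theta : R[i] := cos theta +i* sin theta.

Definition Re_mx n (M : 'M[R[i]]_n) : 'M[R[i]]_n := 2^-1 *: (M + M ^t*).

(* The determinant is real for real lambda and theta, but typed in R[i]. *)
Definition NR_poly n (A : 'M[R[i]]_n) lambda theta : R[i] :=
  \det (Re_mx (expi theta *: A) - (lambda%:C)%:M).

Definition ellipse_factor w x y z lambda theta : R :=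
  (lambda - complex.Re (expi theta * w)) ^+ 2
  - (x * cos (2 * theta) + y * sin (2 * theta) + z).

Definition ellipse_coefs x y z : Prop :=
  Num.sqrt (x ^+ 2 + y ^+ 2) <= z /\ 0 < z.

(* In this case the ellipse is the doubleton of its foci. *)
Definition degenerate_coefs x y z : Prop :=
  z = Num.sqrt (x ^+ 2 + y ^+ 2).

(* A component of the Kippenhahn curve C(A), counted with multiplicity, is a
   factor of NR_poly A; so C(A) consists of three ellipses centered at w when
   NR_poly A is the product of three ellipse factors. Some, but not all, of
   the ellipses may be degenerate. *)
Definition three_concentric_ellipses n (A : 'M[R[i]]_n) : Prop :=
  exists (w : R[i]) (x y z : 'I_3 -> R),
    [/\ forall k, ellipse_coefs (x k) (y k) (z k),
        exists k, ~ degenerate_coefs (x k) (y k) (z k)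
      & forall lambda theta, NR_poly A lambda theta =
          (\prod_(k < 3) ellipse_factor w (x k) (y k) (z k) lambda theta)%:C].

End Kippenhahn.

(* Main.v *)
Require Import Defs.
From mathcomp Require Import all_boot all_order all_algebra.
From mathcomp Require Import complex.
From mathcomp Require Import reals trigo.
From mathcomp Require Import ring lra.

(** Put [t = cos (2 theta)].  The matrix [Re (e^(i theta) A)] is tridiagonal
    with zero diagonal, and reciprocity makes the product of its j-th
    superdiagonal and subdiagonal entries equal to [(A_j + t) / 2].  Expanding the determinant gives
    [P_A = lam^6 - m1 / 2 * lam^4 + m2 / 4 * lam^2 - m3 / 8], where [m_k] is
    the k-th matching sum of the path with six vertices whose edges have
    weights [A_j + t] ([NR_poly_reciprocal6]).

    Suppose that [P_A] is a product of three ellipse factors with center [w].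
    Being even in [lam] it forces [Re (e^(i theta) w) = 0], and the numbers
    [2 (x_k t + y_k sin (2 theta) + z_k)] have [m1, m2, m3] as elementary
    symmetric functions ([even_sextic]).  Since [m3] splits into factors
    [A_j + t] with [A_j >= 1], the roots of the k-th factor, as a
    polynomial in [tan theta], are purely imaginary; this kills [y_k]
    ([axes_aligned]).  So with [Y_k = 2 x_k] and [Z_k = 2 z_k] the problem is
    when [m1, m2, m3], polynomials in [t], are the elementary symmetric
    functions of three affine functions [Y_k t + Z_k].

    The top coefficients in [t] say that the [Y_k] are the roots of
    [Y^3 - 5 Y^2 + 6 Y - 1], the squared eigenvalues of the path itself.  The
    next coefficients are linear in the [Z_k], and as the [Y_k] are distinct
    they determine [Z_k = a + b Y_k + c Y_k^2] with explicit [a, b, c] linear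
    in the [A_j] ([level_unique]).  Three coefficients remain, and by norm
    computations in the cubic field of the [Y_k] they agree exactly when the
    three given polynomials vanish ([esym_level]).

    Conversely these formulas define [Y_k] and [Z_k].  The ellipse condition
    [Z_k >= Y_k] holds because at [t = -1] the numbers [Z_k - Y_k] have
    nonnegative elementary symmetric functions ([esym_ge0]).  In both
    directions the sum of the [A_j] is that of the [Z_k], while the [Y_k] sum
    to 5, so that it exceeds 5 exactly when some [Z_k > Y_k], that is, when
    some ellipse is not degenerate. *)

Set Implicit Arguments.
Unset Strict Implicit.
Unset Printing Implicit Defensive.

Import Order.TTheory GRing.Theory Num.Theory.
Local Open Scope ring_scope.
Local Open Scope complex_scope.

(** * Tridiagonal determinants *)

Definition tridiag (K : nzRingType) n (d u l : nat -> K) : 'M[K]_n :=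
  \matrix_(i, j) if i == j :> nat then d i
                 else if i.+1 == j then u i
                 else if j.+1 == i then l j else 0.

(** Laplace expansion along the first row, then along the first column of the
    minor that the second entry of this row contributes. *)
Lemma det_tridiag_rec (K : comNzRingType) n (d u l : nat -> K) :
  \det (tridiag n.+2 d u l) =
    d 0%N * \det (tridiag n.+1 (d \o succn) (u \o succn) (l \o succn))
    - u 0%N * l 0%N * \det (tridiag n (d \o succn \o succn)
                              (u \o succn \o succn) (l \o succn \o succn)).
Proof.
rewrite (expand_det_row _ ord0) big_ord_recl big_ord_recl big1 ?addr0; last first.
  by move=> j _; rewrite mxE /= mul0r.
rewrite !mxE /= /cofactor.
congr (_ * _ + _).
  rewrite /= expr0 mul1r; congr (\det _); apply/matrixP => i j.
  by rewrite !mxE /= /bump /= !add1n !eqSS.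
rewrite -mulrA -mulrN; congr (_ * _).
rewrite (expand_det_col _ ord0) big_ord_recl big1 ?addr0; last first.
  by move=> j _; rewrite !mxE /= mul0r.
rewrite !mxE /= /cofactor /= expr0 mul1r expr1 mulN1r; congr (- (_ * _)).
congr (\det _); apply/matrixP => i j.
by rewrite !mxE /= /bump /= ?add1n ?eqSS.
Qed.

(** These are the matching sums of the path with six vertices and edge weights
    [a1], ..., [a5]: sums over the sets of 1, 2, 3 pairwise disjoint edges of
    the product of the weights. *)
Definition match1 (V : pzRingType) (a1 a2 a3 a4 a5 : V) : V :=
  a1 + a2 + a3 + a4 + a5.
Definition match2 (V : pzRingType) (a1 a2 a3 a4 a5 : V) : V :=
  a1 * a3 + a1 * a4 + a1 * a5 + a2 * a4 + a2 * a5 + a3 * a5.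
Definition match3 (V : pzRingType) (a1 a2 a3 a4 a5 : V) : V :=
  a1 * a3 * a5.

(** Only transpositions of neighbors contribute to a tridiagonal determinant,
    and disjoint sets of these are the matchings of a path. *)
Lemma det_tridiag6 (K : comNzRingType) (x : K) (u l : nat -> K) :
  let p i := u i * l i in
  \det (tridiag 6 (fun=> - x) u l) =
    x ^+ 6 - match1 (p 0%N) (p 1%N) (p 2%N) (p 3%N) (p 4%N) * x ^+ 4
    + match2 (p 0%N) (p 1%N) (p 2%N) (p 3%N) (p 4%N) * x ^+ 2
    - match3 (p 0%N) (p 1%N) (p 2%N) (p 3%N) (p 4%N).
Proof.
rewrite /= !det_tridiag_rec /= !det_mx11 !det_mx00 !mxE /=.
rewrite /match1 /match2 /match3.
ring.
Qed.

(** * The generating polynomial of a reciprocal matrix *)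

Section GeneratingPolynomial.
Variable R : realType.

Definition sqmod (z : R[i]) : R := complex.Re z ^+ 2 + complex.Im z ^+ 2.

Lemma sqmodE z : (sqmod z)%:C = z * z^*.
Proof. by rewrite add_Re2_Im2 normCK. Qed.

Lemma modulus_meanE n (A : 'M[R[i]]_n.+1) j :
  modulus_mean A j = (sqmod (superdiag A j) + sqmod (subdiag A j)) / 2.
Proof.
by rewrite /modulus_mean /Normc.normc /sqmod; case: (superdiag A j) => ? ?;
   case: (subdiag A j) => ? ?; rewrite !sqr_sqrtr // addr_ge0 ?sqr_ge0.
Qed.

Lemma modulus_mean_ge1 n (A : 'M[R[i]]_n.+1) j :
  reciprocal A -> 1 <= modulus_mean A j.
Proof.
move=> [_ /(_ j)]; rewrite modulus_meanE /sqmod.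
case: (superdiag A j) (subdiag A j) => b1 b2 [c1 c2] /= [bc _].
(* |b - conj c|^2 = |b|^2 + |c|^2 - 2 Re (b c). *)
have := sqr_ge0 (b1 - c1); have := sqr_ge0 (b2 + c2); lra.
Qed.

(** With [e = e^(i t)] of modulus 1, the product expands into
    [(e^2 * (b c) + |b|^2 + |c|^2 + conj (e^2 * (b c))) / 4]. *)
Lemma offdiag_prod (b c : R[i]) (t : R) : b * c = 1 ->
  (2^-1 * (expi t * b + (expi t * c)^*)) * (2^-1 * (expi t * c + (expi t * b)^*))
  = (((sqmod b + sqmod c) / 2 + cos (2 * t)) / 2)%:C.
Proof.
move=> bc.
have ee : expi t * (expi t)^* = 1.
  rewrite -normCK normc_def /= -rmorphXn sqr_sqrtr ?addr_ge0 ?sqr_ge0 //.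
  by rewrite cos2Dsin2.
have ecos : expi t ^+ 2 + (expi t)^* ^+ 2 = 2 * (cos (2 * t))%:C.
  have -> : 2 * t = t *+ 2 by rewrite mulr_natl.
  rewrite cos_mulr2n.
  apply/eqP; rewrite eq_complex /=; move: (cos2Dsin2 t) => ?.
  by apply/andP; split; apply/eqP; lra.
have bc' : b^* * c^* = 1 by rewrite -rmorphM bc rmorph1.
have toC (x y z : R) : (((x + y) / 2 + z) / 2)%:C = ((x%:C + y%:C) / 2 + z%:C) / 2.
  by rewrite !(rmorphM, rmorphD, fmorphV, rmorph_nat).
rewrite toC !sqmodE !rmorphM /=.
have -> : (cos (2 * t))%:C = (expi t ^+ 2 + (expi t)^* ^+ 2) / 2.
  by rewrite ecos; field.
move: (expi t) ee => e ee.
transitivity ((e ^+ 2 * (b * c) + e * e^* * (b * b^* + c * c^*)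
               + e^* ^+ 2 * (b^* * c^*)) / 4).
  by field.
by rewrite bc bc' ee; field.
Qed.

Lemma NR_poly_reciprocal6 (A : 'M[R[i]]_6) (lam t : R) : reciprocal A ->
  let s i := modulus_mean A (inord i) + cos (2 * t) in
  NR_poly A lam t =
    (lam ^+ 6 - match1 (s 0%N) (s 1%N) (s 2%N) (s 3%N) (s 4%N) / 2 * lam ^+ 4
    + match2 (s 0%N) (s 1%N) (s 2%N) (s 3%N) (s 4%N) / 4 * lam ^+ 2
    - match3 (s 0%N) (s 1%N) (s 2%N) (s 3%N) (s 4%N) / 8)%:C.
Proof.
move=> [A0 A1] s.
pose b i := superdiag A (inord i); pose c i := subdiag A (inord i).
pose u i := 2^-1 * (expi t * b i + (expi t * c i)^*).
pose l i := 2^-1 * (expi t * c i + (expi t * b i)^*).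
have ul i : u i * l i = (s i / 2)%:C.
  by rewrite /s modulus_meanE -offdiag_prod.
have -> : NR_poly A lam t = \det (tridiag 6 (fun=> - lam%:C) u l).
  rewrite /NR_poly /Re_mx; congr (\det _); apply/matrixP => i j; rewrite !mxE.
  have superE (k m : 'I_6) : k.+1 = m ->
      superdiag A (inord k) = A k m /\ subdiag A (inord k) = A m k.
    move=> km; have k5 : (k < 5)%N by rewrite -ltnS km.
    rewrite /superdiag /subdiag.
    have -> : widen_ord (leqnSn 5) (inord k) = k.
      by apply: val_inj; rewrite /= inordK.
    have -> : lift ord0 (inord k) = m.
      by apply: val_inj; rewrite /= /bump /= inordK.
    by [].
  have [<-|neq] := eqVneq i j.
    have Aii : A i i = 0 by apply: A0; rewrite eqn_leq ltnn.
    by rewrite eqxx Aii mulr0 rmorph0 add0r mulr0 mulr1n sub0r.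
  have -> : (i == j :> nat) = false by apply: negbTE.
  rewrite mulr0n subr0.
  have [ij|nij] := eqVneq i.+1 (val j).
    by rewrite /u /b /c; have [-> ->] := superE i j ij.
  have [ji|nji] := eqVneq j.+1 (val i).
    by rewrite /l /b /c; have [-> ->] := superE j i ji.
  by rewrite !A0 // ?mulr0 conjC0 add0r mulr0.
rewrite det_tridiag6 !ul /match1 /match2 /match3.
rewrite -!(rmorphB, rmorphD, rmorphM, rmorphXn); congr (_%:C).
by field.
Qed.
End GeneratingPolynomial.

(** * Vieta relations *)

Definition esym1 (V : pzRingType) (f1 f2 f3 : V) := f1 + f2 + f3.
Definition esym2 (V : pzRingType) (f1 f2 f3 : V) := f1 * f2 + f1 * f3 + f2 * f3.
Definition esym3 (V : pzRingType) (f1 f2 f3 : V) := f1 * f2 * f3.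

Definition esym_eq_match (V : pzRingType) (f1 f2 f3 a1 a2 a3 a4 a5 : V) : Prop :=
  [/\ esym1 f1 f2 f3 = match1 a1 a2 a3 a4 a5,
      esym2 f1 f2 f3 = match2 a1 a2 a3 a4 a5
    & esym3 f1 f2 f3 = match3 a1 a2 a3 a4 a5].

Section Vieta.
Variable R : realFieldType.
Implicit Types (a b c d e f r t x y z A : R).

(** The left side is even in [lam], whereas the coefficient of [lam^5] on the
    right is [-6 r]. *)
Lemma even_sextic r f1 f2 f3 e1 e2 e3 :
  (forall lam, lam ^+ 6 - e1 * lam ^+ 4 + e2 * lam ^+ 2 - e3 =
     ((lam - r) ^+ 2 - f1) * ((lam - r) ^+ 2 - f2) * ((lam - r) ^+ 2 - f3)) ->
  [/\ r = 0, esym1 f1 f2 f3 = e1, esym2 f1 f2 f3 = e2 & esym3 f1 f2 f3 = e3].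
Proof.
move=> h.
have r0 : r = 0.
  have := h 1; have := h (-1); have := h 2; have := h (-2).
  have := h 3; have := h (-3); move=> *; lra.
rewrite /esym1 /esym2 /esym3; subst r.
have := h 0; have := h 1; have := h 2; move=> *; split=> //; lra.
Qed.

(** A monic cubic with coefficients of alternating signs is negative at every
    negative number. *)
Lemma esym_ge0 f1 f2 f3 :
  0 <= esym1 f1 f2 f3 -> 0 <= esym2 f1 f2 f3 -> 0 <= esym3 f1 f2 f3 ->
  [/\ 0 <= f1, 0 <= f2 & 0 <= f3].
Proof.
move=> p1 p2 p3.
have root_ge0 x : (x - f1) * (x - f2) * (x - f3) = 0 -> 0 <= x.
  move=> root_x; rewrite leNgt; apply/negP => xneg.
  have x2 : 0 < x ^+ 2 by rewrite exprn_even_gt0 //= lt_eqF.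
  have : x ^+ 3 < 0 by rewrite exprSr pmulr_rlt0.
  have : 0 <= esym1 f1 f2 f3 * x ^+ 2 by rewrite mulr_ge0 // ltW.
  have : esym2 f1 f2 f3 * x <= 0 by rewrite mulr_ge0_le0 // ltW.
  by move: p3; rewrite /esym1 /esym2 /esym3; lra.
by split; apply: root_ge0; rewrite subrr ?mulr0 ?mul0r.
Qed.

Lemma cubic_eq0 (c0 c1 c2 c3 : R) :
  (forall t, -1 <= t <= 1 -> c0 + c1 * t + c2 * t ^+ 2 + c3 * t ^+ 3 = 0) ->
  [/\ c0 = 0, c1 = 0, c2 = 0 & c3 = 0].
Proof.
move=> h; have h0 := h 0; have h1 := h 1; have hN := h (-1); have h2 := h (1 / 2).
move: {h} (h0 ltac:(lra)) (h1 ltac:(lra)) (hN ltac:(lra)) (h2 ltac:(lra)) => *.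
by split; lra.
Qed.

(** At the node [y_i] only the i-th term of the sum survives. *)
Lemma lagrange_eq0 y1 y2 y3 d1 d2 d3 : y1 != y2 -> y1 != y3 -> y2 != y3 ->
  (forall x, d1 * (x - y2) * (x - y3) + d2 * (x - y1) * (x - y3)
             + d3 * (x - y1) * (x - y2) = 0) ->
  [/\ d1 = 0, d2 = 0 & d3 = 0].
Proof.
move=> n12 n13 n23 h.
have cancel (d u v : R) : u != 0 -> v != 0 -> d * u * v = 0 -> d = 0.
  move=> u0 v0 /eqP; rewrite -mulrA mulf_eq0 mulf_eq0.
  by rewrite (negPf u0) (negPf v0) !orbF => /eqP.
split; [apply: (cancel d1 (y1 - y2) (y1 - y3))
       | apply: (cancel d2 (y2 - y1) (y2 - y3))
       | apply: (cancel d3 (y3 - y1) (y3 - y2))]; rewrite ?subr_eq0 // 1?eq_sym //.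
- by rewrite -(h y1); ring.
- by rewrite -(h y2); ring.
- by rewrite -(h y3); ring.
Qed.

(** * The cubic of the path with six vertices *)

(** The roots of [Y^3 - 5 Y^2 + 6 Y - 1] are the numbers
    [4 cos^2 (k pi / 7)], the squared eigenvalues of the path with six
    vertices. *)
Definition path6_roots y1 y2 y3 : Prop :=
  [/\ esym1 y1 y2 y3 = 5, esym2 y1 y2 y3 = 6 & esym3 y1 y2 y3 = 1].

(** The right sides are the trace, the second coefficient and the norm of
    [a + b Y + c Y^2] in the cubic field. *)
Lemma esym_quadratic y1 y2 y3 a b c : path6_roots y1 y2 y3 ->
  let q y := a + b * y + c * y ^+ 2 in
  [/\ esym1 (q y1) (q y2) (q y3) = 3 * a + 5 * b + 13 * c,
      esym2 (q y1) (q y2) (q y3) =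
        3 * a ^+ 2 + 10 * a * b + 26 * a * c + 6 * b ^+ 2 + 27 * b * c + 26 * c ^+ 2
    & esym3 (q y1) (q y2) (q y3) =
        a ^+ 3 + 5 * a ^+ 2 * b + 13 * a ^+ 2 * c + 6 * a * b ^+ 2
        + 27 * a * b * c + 26 * a * c ^+ 2 + b ^+ 3 + 5 * b ^+ 2 * c
        + 6 * b * c ^+ 2 + c ^+ 3].
Proof.
move=> [s1 s2 s3] q; rewrite /q; split.
- transitivity (3 * a + b * esym1 y1 y2 y3
                + c * (esym1 y1 y2 y3 ^+ 2 - 2 * esym2 y1 y2 y3)).
    by rewrite /esym1 /esym2; ring.
  by rewrite s1 s2; ring.
- transitivity (let s1 := esym1 y1 y2 y3 in let s2 := esym2 y1 y2 y3 in
    let s3 := esym3 y1 y2 y3 in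
    3 * a ^+ 2 + 2 * a * b * s1 + 2 * a * c * (s1 ^+ 2 - 2 * s2)
    + b ^+ 2 * s2 + b * c * (s1 * s2 - 3 * s3) + c ^+ 2 * (s2 ^+ 2 - 2 * s1 * s3)).
    by rewrite /= /esym1 /esym2 /esym3; ring.
  by rewrite s1 s2 s3 /=; ring.
transitivity (let s1 := esym1 y1 y2 y3 in let s2 := esym2 y1 y2 y3 in
  let s3 := esym3 y1 y2 y3 in
  a ^+ 3 + a ^+ 2 * b * s1 + a ^+ 2 * c * (s1 ^+ 2 - 2 * s2) + a * b ^+ 2 * s2
  + a * b * c * (s1 * s2 - 3 * s3) + a * c ^+ 2 * (s2 ^+ 2 - 2 * s1 * s3)
  + b ^+ 3 * s3 + b ^+ 2 * c * s1 * s3 + b * c ^+ 2 * s2 * s3 + c ^+ 3 * s3 ^+ 2).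
  by rewrite /= /esym1 /esym2 /esym3; ring.
by rewrite s1 s2 s3 /=; ring.
Qed.

Lemma path6_roots_neq y1 y2 y3 : path6_roots y1 y2 y3 ->
  [/\ y1 != y2, y1 != y3 & y2 != y3].
Proof.
move=> [s1 s2 s3].
(* The discriminant of the cubic. *)
have disc : ((y1 - y2) * (y1 - y3) * (y2 - y3)) ^+ 2 = 49.
  transitivity (let s1 := esym1 y1 y2 y3 in let s2 := esym2 y1 y2 y3 in
    let s3 := esym3 y1 y2 y3 in
    s1 ^+ 2 * s2 ^+ 2 - 4 * s2 ^+ 3 - 4 * s1 ^+ 3 * s3 + 18 * s1 * s2 * s3
    - 27 * s3 ^+ 2).
    by rewrite /= /esym1 /esym2 /esym3; ring.
  by rewrite s1 s2 s3 /=; ring.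
have : (y1 - y2) * (y1 - y3) * (y2 - y3) != 0.
  by rewrite -sqrf_eq0 disc pnatr_eq0.
by rewrite !mulf_eq0 !subr_eq0 !negb_or -andbA => /and3P.
Qed.

(** * Matching sums as symmetric functions of affine functions *)

Section Level.
Variables A1 A2 A3 A4 A5 : R.

(** The coefficients [a, b, c] come from inverting the matrix of the trace
    form of the basis [1, Y, Y^2], so that the linear conditions of
    [level_unique] hold for [z_k = level y_k]. *)
Definition level_const := (2 * A3 - A2 - A4) / 7.
Definition level_lin := (4 * A1 + 2 * A2 - 5 * A3 + 2 * A4 + 4 * A5) / 7.
Definition level_quad := (2 * A3 - A1 - A5) / 7.
Definition level y := level_const + level_lin * y + level_quad * y ^+ 2.

Definition quadric1 : R :=
  - (A2 ^+ 2 + A4 ^+ 2) - 2 * (A1 ^+ 2 + A5 ^+ 2)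
  + 2 * A3 * (A1 - A2 - A4 + A5)
  + 3 * (A1 * A4 + A1 * A5 + A2 * A5)
  - 4 * (A1 * A2 + A4 * A5) + 5 * A2 * A4.

Definition quadric2 : R :=
  A2 ^+ 2 - A3 ^+ 2 + A4 ^+ 2
  + 3 * (A1 * A3 + A1 * A5 + A3 * A5)
  - 2 * (A1 ^+ 2 + A5 ^+ 2 + A2 * A3 - A2 * A4 + A3 * A4)
  - (A1 + A5) * (A2 + A4).

Definition cubic3 : R :=
  - A1 ^+ 3 + A2 ^+ 3 + A3 ^+ 3 + A4 ^+ 3 - A5 ^+ 3
  + (A1 - A3 + A5) * (A2 ^+ 2 + A4 ^+ 2)
  - 2 * (A2 + A4) * (A1 ^+ 2 + A3 ^+ 2 + A5 ^+ 2)
  + 2 * A2 * A4 * (A1 - A3 + A5)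
  - 3 * (A2 + A4) * (A3 * (A1 + A5) - A2 * A4)
  - 3 * (A1 + A5) * (A3 ^+ 2 + A1 * A5)
  - 4 * (A1 ^+ 2 * A3 + A3 * A5 ^+ 2 + A1 * A2 * A5 + A1 * A4 * A5)
  + 41 * A1 * A3 * A5.

(** Adding [y t] to [level y] only shifts the middle coefficient [b] by [t];
    the three polynomials are what is left over between the forms of
    [esym_quadratic] and the matching sums. *)
Lemma esym_level y1 y2 y3 t : path6_roots y1 y2 y3 ->
  let f y := y * t + level y in
  [/\ esym1 (f y1) (f y2) (f y3)
        = match1 (A1 + t) (A2 + t) (A3 + t) (A4 + t) (A5 + t),
      esym2 (f y1) (f y2) (f y3)
        = match2 (A1 + t) (A2 + t) (A3 + t) (A4 + t) (A5 + t) - quadric1 / 7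
    & esym3 (f y1) (f y2) (f y3)
        = match3 (A1 + t) (A2 + t) (A3 + t) (A4 + t) (A5 + t)
          - t * quadric2 / 7 - cubic3 / 49].
Proof.
move=> ys f.
have fE y : f y = level_const + (level_lin + t) * y + level_quad * y ^+ 2.
  by rewrite /f /level; ring.
have [e1 e2 e3] := esym_quadratic level_const (level_lin + t) level_quad ys.
rewrite !fE e1 e2 e3 /match1 /match2 /match3 /quadric1 /quadric2 /cubic3.
rewrite /level_const /level_lin /level_quad.
by split; field.
Qed.

(** The three sums are the coefficients in [x] of
    [sum_k z_k (x - y_i) (x - y_j)]; hence, the nodes being distinct, they
    determine the [z_k], and [level y_k] gives the same sums. *)
Lemma level_unique y1 y2 y3 z1 z2 z3 : path6_roots y1 y2 y3 ->
  z1 + z2 + z3 = A1 + A2 + A3 + A4 + A5 ->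
  y1 * (z2 + z3) + y2 * (z1 + z3) + y3 * (z1 + z2)
    = 3 * (A1 + A5) + 2 * (A2 + A3 + A4) ->
  z1 * y2 * y3 + y1 * z2 * y3 + y1 * y2 * z3 = A1 + A3 + A5 ->
  [/\ z1 = level y1, z2 = level y2 & z3 = level y3].
Proof.
move=> ys l1 l2 l3; have [n12 n13 n23] := path6_roots_neq ys.
(* The sums for level y_k are coefficients in t of the identities of
   esym_level; finite differences at t = -1, 0, 1 extract them. *)
have [/= a1 a2 a3] := esym_level 0 ys; have [/= _ b2 b3] := esym_level 1 ys.
have [/= _ c2 c3] := esym_level (-1) ys.
rewrite /esym1 /esym2 /esym3 /match1 /match2 /match3 in a1 a2 a3 b2 b3 c2 c3.
have lag x : (z1 - level y1) * (x - y2) * (x - y3)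
  + (z2 - level y2) * (x - y1) * (x - y3)
  + (z3 - level y3) * (x - y1) * (x - y2) = 0.
  move: (level y1) (level y2) (level y3) a1 a2 a3 b2 b3 c2 c3.
  move=> w1 w2 w3 a1 a2 a3 b2 b3 c2 c3.
  have m1 : w1 + w2 + w3 = z1 + z2 + z3 by lra.
  have m2 : y1 * (w2 + w3) + y2 * (w1 + w3) + y3 * (w1 + w2)
    = y1 * (z2 + z3) + y2 * (z1 + z3) + y3 * (z1 + z2) by lra.
  have m3 : w1 * y2 * y3 + y1 * w2 * y3 + y1 * y2 * w3
    = z1 * y2 * y3 + y1 * z2 * y3 + y1 * y2 * z3 by lra.
  transitivity (x ^+ 2 * ((z1 + z2 + z3) - (w1 + w2 + w3))
   - x * ((y1 * (z2 + z3) + y2 * (z1 + z3) + y3 * (z1 + z2))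
           - (y1 * (w2 + w3) + y2 * (w1 + w3) + y3 * (w1 + w2)))
   + ((z1 * y2 * y3 + y1 * z2 * y3 + y1 * y2 * z3)
         - (w1 * y2 * y3 + y1 * w2 * y3 + y1 * y2 * w3))).
    by ring.
  by rewrite m1 m2 m3 !subrr; ring.
by have [/subr0_eq-> /subr0_eq-> /subr0_eq->] := lagrange_eq0 n12 n13 n23 lag.
Qed.

(** Comparing the leading coefficients in [t] of the three identities yields
    the cubic of the [y_k], and the next ones the linear conditions of
    [level_unique]. *)
Lemma esym_eq_match_level y1 y2 y3 z1 z2 z3 :
  (forall t, -1 <= t <= 1 ->
    esym_eq_match (y1 * t + z1) (y2 * t + z2) (y3 * t + z3)
      (A1 + t) (A2 + t) (A3 + t) (A4 + t) (A5 + t)) ->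
  path6_roots y1 y2 y3 /\ [/\ z1 = level y1, z2 = level y2 & z3 = level y3].
Proof.
rewrite /esym_eq_match /esym1 /esym2 /esym3 /match1 /match2 /match3 => h.
have [e10 e11 _ _] := @cubic_eq0 (z1 + z2 + z3 - (A1 + A2 + A3 + A4 + A5))
  (y1 + y2 + y3 - 5) 0 0 ltac:(move=> t /h [e1 _ _]; lra).
have [_ e21 e22 _] := @cubic_eq0
  (z1 * z2 + z1 * z3 + z2 * z3 - match2 A1 A2 A3 A4 A5)
  (y1 * (z2 + z3) + y2 * (z1 + z3) + y3 * (z1 + z2)
   - (3 * (A1 + A5) + 2 * (A2 + A3 + A4)))
  (esym2 y1 y2 y3 - 6) 0
  ltac:(rewrite /match2 /esym2; move=> t /h [_ e2 _]; lra).
have [_ _ e32 e33] := @cubic_eq0 (z1 * z2 * z3 - A1 * A3 * A5)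
  (y1 * z2 * z3 + z1 * y2 * z3 + z1 * z2 * y3 - (A1 * A3 + A1 * A5 + A3 * A5))
  (z1 * y2 * y3 + y1 * z2 * y3 + y1 * y2 * z3 - (A1 + A3 + A5))
  (esym3 y1 y2 y3 - 1)
  ltac:(rewrite /esym3; move=> t /h [_ _ e3]; lra).
have ys : path6_roots y1 y2 y3 by split; apply/subr0_eq.
by split=> //; apply: level_unique => //; apply/subr0_eq.
Qed.

Lemma level_eq_matchP y1 y2 y3 : path6_roots y1 y2 y3 ->
  (forall t, -1 <= t <= 1 ->
    esym_eq_match (y1 * t + level y1) (y2 * t + level y2) (y3 * t + level y3)
      (A1 + t) (A2 + t) (A3 + t) (A4 + t) (A5 + t)) <->
  [/\ quadric1 = 0, quadric2 = 0 & cubic3 = 0].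
Proof.
move=> ys; split=> [h|[q1 q2 q3] t _]; last first.
  have [/= e1 e2 e3] := esym_level t ys.
  by rewrite /esym_eq_match e1 e2 e3 q1 q2 q3 !(mulr0, mul0r, subr0).
have [/= _ e2 e3] := esym_level 0 ys; have [/= _ _ e3'] := esym_level 1 ys.
have [_] := h 0 ltac:(lra); rewrite e2 e3 => q1 q3.
have [_ _] := h 1 ltac:(lra); rewrite e3' => q2.
by split; lra.
Qed.
End Level.
End Vieta.

(** The cubic changes sign on [0, 1], on [1, 3] and on [3, 4]. *)
Lemma path6_roots_exist (F : rcfType) : exists y1 y2 y3 : F,
  [/\ 0 < y1, 0 < y2, 0 < y3 & path6_roots y1 y2 y3].
Proof.
pose p : {poly F} := 'X^3 - 5 *: 'X^2 + 6 *: 'X - 1.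
have pE x : p.[x] = x ^+ 3 - 5 * x ^+ 2 + 6 * x - 1 by rewrite /p !hornerE.
have [y1 /andP[a1 b1] /rootP r1] : exists2 x, 0 <= x <= 1 & root p x.
  by apply: poly_ivt; rewrite ?pE; lra.
have [y2 /andP[a2 b2]] : exists2 x, 1 <= x <= 3 & root (- p) x.
  by apply: poly_ivt; rewrite ?hornerN ?pE; lra.
rewrite rootN => /rootP r2.
have [y3 /andP[a3 b3] /rootP r3] : exists2 x, 3 <= x <= 4 & root p x.
  by apply: poly_ivt; rewrite ?pE; lra.
rewrite !pE in r1 r2 r3.
have y10 : y1 != 0 by apply/eqP => e; move: r1; rewrite e; lra.
have y11 : y1 != 1 by apply/eqP => e; move: r1; rewrite e; lra.
have y23 : y2 != 3 by apply/eqP => e; move: r2; rewrite e; lra.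
have y1gt : 0 < y1 by rewrite lt_neqAle eq_sym y10.
have y1lt : y1 < 1 by rewrite lt_neqAle y11.
have y2lt : y2 < 3 by rewrite lt_neqAle y23.
(* Divided differences of the cubic at its roots give Vieta's formulas. *)
have h12 : y1 ^+ 2 + y1 * y2 + y2 ^+ 2 - 5 * (y1 + y2) + 6 = 0.
  apply: (@mulfI _ (y1 - y2)); first by rewrite subr_eq0 lt_eqF //; lra.
  by lra.
have h23 : y2 ^+ 2 + y2 * y3 + y3 ^+ 2 - 5 * (y2 + y3) + 6 = 0.
  apply: (@mulfI _ (y2 - y3)); first by rewrite subr_eq0 lt_eqF //; lra.
  by lra.
have s1 : y1 + y2 + y3 = 5.
  apply: (@mulfI _ (y1 - y3)); first by rewrite subr_eq0 lt_eqF //; lra.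
  by lra.
have y3E : y3 = 5 - y1 - y2 by lra.
exists y1, y2, y3; rewrite /path6_roots /esym1 /esym2 /esym3; split; [lra..|].
split=> //; first by rewrite y3E; lra.
have : y1 * (y1 ^+ 2 + y1 * y2 + y2 ^+ 2 - 5 * (y1 + y2) + 6) = 0.
  by rewrite h12 mulr0.
by rewrite y3E; lra.
Qed.

(** * Alignment of the axes *)

Lemma poly_vanish_nat (K : numDomainType) (p : {poly K}) :
  (forall n : nat, p.[n%:R] = 0) -> p = 0.
Proof.
move=> p0; pose rs := [seq n%:R : K | n <- iota 0 (size p)].
apply: (@roots_geq_poly_eq0 _ p rs).
- by apply/allP => _ /mapP[n _ ->]; apply/rootP.
- by rewrite map_inj_uniq ?iota_uniq // => m n /eqP; rewrite eqr_nat => /eqP.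
- by rewrite size_map size_iota.
Qed.

Section Axes.
Variable R : realType.

Lemma half_angle (t : R) : exists theta,
  (1 + t ^+ 2) * cos (2 * theta) = 1 - t ^+ 2 /\
  (1 + t ^+ 2) * sin (2 * theta) = 2 * t.
Proof.
exists (atan t); rewrite mulr_natl cos_mulr2n sin_mulr2n.
have c0 : cos (atan t) != 0.
  by rewrite cos_atan invr_neq0 // sqrtr_eq0 -ltNge; have := sqr_ge0 t; lra.
have tanK := atanK t; rewrite /tan in tanK.
have ct : sin (atan t) = t * cos (atan t) by rewrite -{2}tanK mulfVK.
have cc : (1 + t ^+ 2) * cos (atan t) ^+ 2 = 1.
  by rewrite -{1}(atanK t) -cos2_tan2 // mulVf // expf_neq0.
rewrite ct; split; first by lra.
transitivity (2 * t * ((1 + t ^+ 2) * cos (atan t) ^+ 2)); first by ring.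
by rewrite cc mulr1.
Qed.

(** Substituting [t = tan theta] and clearing denominators turns the identity
    into one between polynomials in [t], with real quadratic factors
    [(z_k - x_k) t^2 + 2 y_k t + (z_k + x_k)] on the left and
    [(a_j - 1) t^2 + (a_j + 1)] on the right.  A complex root of a factor on
    the left has real part [- y_k / (z_k - x_k)], and all roots on the right
    are purely imaginary. *)
Lemma axes_aligned n (x y z : 'I_n -> R) (a : 'I_n -> R) (d : R) :
  (forall k, ellipse_coefs (x k) (y k) (z k)) -> d != 0 -> (forall j, 1 <= a j) ->
  (forall theta, \prod_k (x k * cos (2 * theta) + y k * sin (2 * theta) + z k)
                 = d * \prod_j (a j + cos (2 * theta))) ->
  forall k, y k = 0.
Proof.
move=> ell d0 a1 trig k.
have real t : \prod_k ((z k - x k) * t ^+ 2 + 2 * y k * t + (z k + x k))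
   = d * \prod_j ((a j - 1) * t ^+ 2 + (a j + 1)).
  have [theta [hc hs]] := half_angle t.
  transitivity (\prod_(i < n) (1 + t ^+ 2) *
                \prod_k (x k * cos (2 * theta) + y k * sin (2 * theta) + z k)).
    rewrite -big_split; apply: eq_bigr => i _ /=.
    transitivity (x i * ((1 + t ^+ 2) * cos (2 * theta))
      + y i * ((1 + t ^+ 2) * sin (2 * theta)) + z i * (1 + t ^+ 2)); last by ring.
    by rewrite hc hs; ring.
  rewrite trig mulrCA -big_split; congr (_ * _); apply: eq_bigr => i _ /=.
  transitivity (a i * (1 + t ^+ 2) + (1 + t ^+ 2) * cos (2 * theta)); first by ring.
  by rewrite hc; ring.
pose p := \prod_k ((z k - x k)%:C *: 'X^2 + (2 * y k)%:C *: 'X + (z k + x k)%:C%:P)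
  - d%:C *: \prod_j ((a j - 1)%:C *: 'X^2 + (a j + 1)%:C%:P).
have pE u : p.[u] =
    \prod_k ((z k - x k)%:C * u ^+ 2 + (2 * y k)%:C * u + (z k + x k)%:C)
    - d%:C * \prod_j ((a j - 1)%:C * u ^+ 2 + (a j + 1)%:C).
  rewrite /p !hornerE !horner_prod; congr (_ - _ * _);
  by apply: eq_bigr => i _; rewrite !hornerE.
have p0 : p = 0.
  apply: poly_vanish_nat => m; rewrite pE.
  have /(congr1 (real_complex R)) := real m%:R.
  rewrite rmorphM !rmorph_prod => e; apply/eqP; rewrite subr_eq0; apply/eqP.
  have mC : (m%:R : R)%:C = m%:R by rewrite rmorph_nat.
  rewrite -mC; etransitivity; [etransitivity; [|exact: e]|]; [|congr (_ * _)];
  by apply: eq_bigr => i _; rewrite !(rmorphD, rmorphM, rmorphXn).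
have [xyz zpos] : x k ^+ 2 + y k ^+ 2 <= z k ^+ 2 /\ 0 < z k.
  have [le_z z0] := ell k; split=> //.
  by rewrite -ler_sqrt ?sqr_ge0 // sqrtr_sqr (gtr0_norm z0).
(* When z_k = x_k the factor has no square term, but then y_k^2 <= 0. *)
have [zxk|zxk] := eqVneq (z k) (x k).
  by apply/eqP; rewrite -sqrf_eq0; apply/eqP; have := sqr_ge0 (y k); nra.
have zxgt : 0 < z k - x k by rewrite lt_neqAle eq_sym subr_eq0 zxk /=; nra.
have [s ss] : exists s : R, s ^+ 2 = z k ^+ 2 - x k ^+ 2 - y k ^+ 2.
  by exists (Num.sqrt (z k ^+ 2 - x k ^+ 2 - y k ^+ 2)); rewrite sqr_sqrtr //; lra.
have [u [v [uE vE]]] : exists u v : R,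
    (z k - x k) * u = - y k /\ (z k - x k) * v = s.
  exists (- y k / (z k - x k)), (s / (z k - x k)).
  by rewrite ![(z k - x k) * _]mulrC !divfK ?gt_eqF.
have qk0 : (z k - x k)%:C * (u +i* v) ^+ 2 + (2 * y k)%:C * (u +i* v)
           + (z k + x k)%:C = 0.
  apply/eqP; rewrite eq_complex /=.
  apply/andP; split; apply/eqP; last first.
    transitivity (2 * v * ((z k - x k) * u + y k)); first by ring.
    by rewrite uE addNr mulr0.
  apply: (@mulfI _ (z k - x k)); first by rewrite gt_eqF.
  transitivity (((z k - x k) * u) ^+ 2 - ((z k - x k) * v) ^+ 2
    + 2 * y k * ((z k - x k) * u) + (z k ^+ 2 - x k ^+ 2)); first by ring.
  by rewrite uE vE ss; ring.
have := pE (u +i* v).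
rewrite p0 horner0 (bigD1 k) //= qk0 mul0r sub0r => /esym /eqP.
have dC : d%:C != 0 by rewrite eq_complex /= negb_and d0.
rewrite oppr_eq0 mulf_eq0 (negPf dC) /= => /prodf_eq0[j _].
rewrite eq_complex /= => /andP[/eqP re /eqP im].
have aj := a1 j.
(* For a_j = 1 the factor is the nonzero constant 2. *)
have aj_neq1 : a j - 1 != 0 by apply/eqP => e; move: re; rewrite e; lra.
have /eqP : u * v = 0 by apply: (mulfI aj_neq1); lra.
rewrite mulf_eq0 => /orP[]/eqP e; first by move: uE; rewrite e; lra.
have : 0 <= (a j - 1) * u ^+ 2 by rewrite mulr_ge0 ?sqr_ge0 // subr_ge0.
by move: re; rewrite e; lra.
Qed.
End Axes.

(** * The two implications *)

Section Ellipses.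
Variables (R : realType) (A : 'M[R[i]]_6).
Hypothesis hA : reciprocal A.
Let A1 := modulus_mean A (inord 0).
Let A2 := modulus_mean A (inord 1).
Let A3 := modulus_mean A (inord 2).
Let A4 := modulus_mean A (inord 3).
Let A5 := modulus_mean A (inord 4).

Lemma three_concentric_ellipses_equations : three_concentric_ellipses A ->
  [/\ quadric1 A1 A2 A3 A4 A5 = 0, quadric2 A1 A2 A3 A4 A5 = 0,
      cubic3 A1 A2 A3 A4 A5 = 0 & 5 < A1 + A2 + A3 + A4 + A5].
Proof.
move=> [w [x [y [z [ell [k0 ndeg] prodE]]]]].
pose f k th := x k * cos (2 * th) + y k * sin (2 * th) + z k.
pose k1 : 'I_3 := ord0; pose k2 : 'I_3 := lift ord0 ord0.
pose k3 : 'I_3 := lift ord0 (lift ord0 ord0).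
have symE th : let t := cos (2 * th) in
    esym_eq_match (2 * f k1 th) (2 * f k2 th) (2 * f k3 th)
      (A1 + t) (A2 + t) (A3 + t) (A4 + t) (A5 + t).
  move=> t.
  pose r := complex.Re (expi th * w).
  have prod3 lam : \prod_(k < 3) ellipse_factor w (x k) (y k) (z k) lam th
    = ((lam - r) ^+ 2 - f k1 th) * ((lam - r) ^+ 2 - f k2 th)
      * ((lam - r) ^+ 2 - f k3 th).
    by rewrite !big_ord_recl big_ord0 mulr1 mulrA.
  have lamE lam :=
    complexI (etrans (esym (NR_poly_reciprocal6 lam th hA)) (prodE lam th)).
  have [_] := even_sextic (fun lam => etrans (lamE lam) (prod3 lam)).
  rewrite -/A1 -/A2 -/A3 -/A4 -/A5 -/t /esym_eq_match /esym1 /esym2 /esym3.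
  move=> e1 e2 e3; split; lra.
pose a (j : 'I_3) := nth 0 [:: A1; A3; A5] j.
have y0 : forall k, y k = 0.
  (* The constant 1 / 8 compares the products of the f_k and of the 2 f_k. *)
  apply: (@axes_aligned _ _ x y z a (1 / 8)) => //.
  - by apply/eqP; lra.
  - by move=> [[|[|[|]]] // ?]; apply: modulus_mean_ge1.
  move=> th; have [_ _ /=] := symE th.
  rewrite !big_ord_recl !big_ord0 !mulr1 /a /= /esym3 /match3 /f /k1 /k2 /k3.
  lra.
have affine t : -1 <= t <= 1 -> let g k := 2 * x k * t + 2 * z k in
    esym_eq_match (g k1) (g k2) (g k3) (A1 + t) (A2 + t) (A3 + t) (A4 + t) (A5 + t).
  move=> t11 g; have ct : cos (2 * (acos t / 2)) = t.
    by rewrite mulrC divfK ?pnatr_eq0 // acosK.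
  have fg k : 2 * f k (acos t / 2) = g k.
    by rewrite /f /g y0 ct; ring.
  by have := symE (acos t / 2); rewrite /= !fg ct.
have [ys [z1 z2 z3]] := esym_eq_match_level affine.
have [q1 q2 q3] : [/\ quadric1 A1 A2 A3 A4 A5 = 0, quadric2 A1 A2 A3 A4 A5 = 0
                    & cubic3 A1 A2 A3 A4 A5 = 0].
  by apply/(level_eq_matchP _ _ _ _ _ ys) => t /affine; rewrite /= z1 z2 z3.
split=> //.
have [/= sumz _ _] := affine 0 ltac:(lra); have [sumx _ _] := ys.
have xz k : x k <= z k.
  have [+ _] := ell k; rewrite y0 expr0n addr0 sqrtr_sqr.
  by apply: le_trans; apply: ler_norm.
have xz0 : x k0 < z k0.
  have [h _] := ell k0; rewrite y0 expr0n addr0 sqrtr_sqr in h.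
  apply: le_lt_trans (ler_norm _) _; rewrite lt_neqAle h andbT.
  by apply/eqP => e; apply: ndeg; rewrite /degenerate_coefs y0 expr0n addr0 sqrtr_sqr.
have : \sum_k x k < \sum_k z k.
  by rewrite (bigD1 k0) //= [ltRHS](bigD1 k0) //= ltr_leD // ler_sum.
rewrite !big_ord_recl !big_ord0.
rewrite /esym1 /match1 /k1 /k2 /k3 in sumz sumx *; lra.
Qed.

Lemma equations_three_concentric_ellipses :
  [/\ quadric1 A1 A2 A3 A4 A5 = 0, quadric2 A1 A2 A3 A4 A5 = 0,
      cubic3 A1 A2 A3 A4 A5 = 0 & 5 < A1 + A2 + A3 + A4 + A5] ->
  three_concentric_ellipses A.
Proof.
move=> [q1 q2 q3 sumA].
have [y1 [y2 [y3 [y1pos y2pos y3pos ys]]]] := path6_roots_exist R.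
pose L := level A1 A2 A3 A4 A5.
have symE := (level_eq_matchP A1 A2 A3 A4 A5 ys).2 (And3 q1 q2 q3).
have [le1 le2 le3] : [/\ y1 <= L y1, y2 <= L y2 & y3 <= L y3].
  have ge0 i : 0 <= modulus_mean A i + -1 by rewrite subr_ge0 modulus_mean_ge1.
  have [e1 e2 e3] := symE (-1) ltac:(lra).
  have [|||g1 g2 g3] := @esym_ge0 _ (y1 * -1 + L y1) (y2 * -1 + L y2) (y3 * -1 + L y3).
  - by rewrite e1 /match1 /A1 /A2 /A3 /A4 /A5 !(ge0, addr_ge0).
  - by rewrite e2 /match2 /A1 /A2 /A3 /A4 /A5 !(ge0, mulr_ge0, addr_ge0).
  - by rewrite e3 /match3 /A1 /A3 /A5 !(ge0, mulr_ge0).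
  by split; lra.
pose yk (k : 'I_3) := nth 0 [:: y1; y2; y3] k.
have ykP k : 0 < yk k /\ yk k <= L (yk k).
  by case: k => [[|[|[|]]] //= ?]; rewrite /yk /=; split.
exists 0, (fun k => yk k / 2), (fun=> 0), (fun k => L (yk k) / 2); split.
- move=> k; have [pk lk] := ykP k.
  rewrite /ellipse_coefs expr0n addr0 sqrtr_sqr ger0_norm; last by lra.
  by split; lra.
- have [k yL] : exists k, yk k != L (yk k).
    apply/existsP; rewrite -[[exists _, _]]negbK negb_exists.
    apply/negP => /forallP all_eq.
    have [/= s _ _] := symE 0 ltac:(lra); have [s5 _ _] := ys.
    have := all_eq ord0; have := all_eq (lift ord0 ord0).
    have := all_eq (lift ord0 (lift ord0 ord0)).
    rewrite !negbK /yk /= => /eqP l3 /eqP l2 /eqP l1.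
    by rewrite /esym1 /match1 -/L -l1 -l2 -l3 in s s5; lra.
  exists k; have [pk _] := ykP k.
  rewrite /degenerate_coefs expr0n addr0 sqrtr_sqr ger0_norm; last by lra.
  by move=> e; move/eqP: yL; apply; lra.
move=> lam th; rewrite (NR_poly_reciprocal6 lam th hA) -/A1 -/A2 -/A3 -/A4 -/A5.
congr (_%:C); rewrite !big_ord_recl big_ord0 mulr1 /ellipse_factor mulr0 /= /yk /=.
have [|<- <- <-] := symE (cos (2 * th)); first by rewrite cos_geN1 cos_le1.
by rewrite -/L /esym1 /esym2 /esym3; field.
Qed.
End Ellipses.

Theorem theorem10 (R : realType) (A : 'M[R[i]]_6) (A1 A2 A3 A4 A5 : R)
    (hA : reciprocal A)
    (hA1 : A1 = modulus_mean A (inord 0))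
    (hA2 : A2 = modulus_mean A (inord 1))
    (hA3 : A3 = modulus_mean A (inord 2))
    (hA4 : A4 = modulus_mean A (inord 3))
    (hA5 : A5 = modulus_mean A (inord 4)) :
  three_concentric_ellipses A <->
  [/\ - (A2 ^+ 2 + A4 ^+ 2) - 2 * (A1 ^+ 2 + A5 ^+ 2)
        + 2 * A3 * (A1 - A2 - A4 + A5)
        + 3 * (A1 * A4 + A1 * A5 + A2 * A5)
        - 4 * (A1 * A2 + A4 * A5) + 5 * A2 * A4 = 0,
      A2 ^+ 2 - A3 ^+ 2 + A4 ^+ 2
        + 3 * (A1 * A3 + A1 * A5 + A3 * A5)
        - 2 * (A1 ^+ 2 + A5 ^+ 2 + A2 * A3 - A2 * A4 + A3 * A4)
        - (A1 + A5) * (A2 + A4) = 0,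
      - A1 ^+ 3 + A2 ^+ 3 + A3 ^+ 3 + A4 ^+ 3 - A5 ^+ 3
        + (A1 - A3 + A5) * (A2 ^+ 2 + A4 ^+ 2)
        - 2 * (A2 + A4) * (A1 ^+ 2 + A3 ^+ 2 + A5 ^+ 2)
        + 2 * A2 * A4 * (A1 - A3 + A5)
        - 3 * (A2 + A4) * (A3 * (A1 + A5) - A2 * A4)
        - 3 * (A1 + A5) * (A3 ^+ 2 + A1 * A5)
        - 4 * (A1 ^+ 2 * A3 + A3 * A5 ^+ 2 + A1 * A2 * A5 + A1 * A4 * A5)
        + 41 * A1 * A3 * A5 = 0
    & 5 < A1 + A2 + A3 + A4 + A5].
Proof.
subst; split.
- exact: three_concentric_ellipses_equations.
- exact: equations_three_concentric_ellipses.
Qed.
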